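(* Let $a=a(n)$ and $k=k(n)$ be positive integers (functions of $n$) with $k=o(n)$ and $a=o(\sqrt n)$. For every $\varepsilon>0$ there is an $n_0\in\mathbb N$ (depending on $\varepsilon$ and on the functions $a,k$) such that for every $n\ge n_0$ and every integer $b\ge(1+\varepsilon)\frac{an}{a+\ln n}$, Breaker has a winning strategy in the $(a:b)$ minimum-degree-$k$ Maker-Breaker game on $K_n$ in which Breaker moves first.
   Context: The $(a:b)$ minimum-degree-$k$ Maker-Breaker game on $K_n$: the board is the edge set of the complete graph $K_n$ on $n$ vertices. In each round Breaker first claims $b$ previously unclaimed edges, then Maker claims $a$ previously unclaimed edges (if fewer edges remain, a player claims all remaining ones). Maker wins if at the end of the game his edges form a spanning subgraph of minimum degree at least $k$; otherwise Breaker wins. *)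

(* Defs.v *)
From HB Require Import structures.
From mathcomp Require Import all_boot all_order all_algebra.
From mathcomp Require Import all_classical all_reals all_analysis.

Set Implicit Arguments.
Unset Strict Implicit.
Unset Printing Implicit Defensive.

Section MakerBreaker.
Variable T : finType.

(* A round is (Breaker's move, Maker's reply); a history lists the completed
   rounds, oldest first. *)
Definition history : Type := seq ({set T} * {set T}).

Definition breaker_claims (h : history) : {set T} := \bigcup_(r <- h) r.1.
Definition maker_claims (h : history) : {set T} := \bigcup_(r <- h) r.2.

Definition unclaimed (X : {set T}) (h : history) : {set T} :=
  X :\: (breaker_claims h :|: maker_claims h).

(* With bias q and set F of unclaimed elements, a player claims exactly q
   elements of F, or all of F if fewer than q remain. *)
Definition legal_move (q : nat) (F S : {set T}) : bool :=
  (S \subset F) && (#|S| == minn q #|F|).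

Definition breaker_strategy : Type := history -> {set T}.

(* The histories reachable in the (a : b) game on X when Breaker, who opens
   each round, follows s and Maker makes arbitrary legal moves. *)
Inductive consistent (X : {set T}) (a : nat) (s : breaker_strategy) :
    history -> Prop :=
| consistent_nil : consistent X a s [::]
| consistent_round (h : history) (m : {set T}) :
    consistent X a s h ->
    legal_move a (unclaimed X h :\: s h) m ->
    consistent X a s (rcons h (s h, m)).

(* The game is over once the board is exhausted, which always happens when
   b > 0; from then on both players' only legal move is the empty set. *)
Definition breaker_winning_strategy (X : {set T}) (a b : nat)
    (maker_wins : pred {set T}) (s : breaker_strategy) : Prop :=
  forall h : history, consistent X a s h ->
    legal_move b (unclaimed X h) (s h) /\
    (unclaimed X h = finset.set0 -> ~~ maker_wins (maker_claims h)).

Definition breaker_has_winning_strategy (X : {set T}) (a b : nat)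
    (maker_wins : pred {set T}) : Prop :=
  exists s : breaker_strategy, breaker_winning_strategy X a b maker_wins s.

End MakerBreaker.

Definition complete_graph (n : nat) : {set {set 'I_n}} :=
  finset (fun e : {set 'I_n} => #|e| == 2).

Definition degree (n : nat) (G : {set {set 'I_n}}) (v : 'I_n) : nat :=
  #|finset (fun e : {set 'I_n} => (e \in G) && (v \in e))|.

Definition min_degree_ge (n k : nat) (G : {set {set 'I_n}}) : bool :=
  [forall v : 'I_n, k <= degree G v].

(* Main.v *)
(* Since k >= 1, it suffices for Breaker to claim all edges at one vertex.  If
   b >= n - 1 his first move does it; otherwise a < (ln n) / eps.  Put
   t = n / (ln n)^3.  Breaker first builds, adding a + 1 vertices per round, a
   clique of 1 + a t vertices none of which Maker has touched: the m-th round
   costs him about (a + 1) m edges, and Maker touches at most a of its vertices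
   per round since every edge he can still claim leaves the clique.  Then the
   stars of the clique vertices are disjoint boxes and Breaker plays the box
   game: reducing all surviving stars evenly while Maker destroys at most a of
   them per round, he can remove
     b + b / (1 + a) + ... + b / (1 + a t) >= (b / a) (a + ln t - O(1)) >= n
   edges from the last one. *)
Require Import Defs.
From HB Require Import structures.
From mathcomp Require Import all_boot all_order all_algebra.
From mathcomp Require Import boolp zify.

Set Implicit Arguments.
Unset Strict Implicit.
Unset Printing Implicit Defensive.

(** * Completing a set to a legal move *)

Lemma exists_subset_card (T : finType) (S F : {set T}) (q : nat) :
  S \subset F -> #|S| <= q <= #|F| ->
  exists2 S' : {set T}, S \subset S' & (S' \subset F) && (#|S'| == q).
Proof.
move=> SF /andP[Sq qF].
pose D := [set x in take (q - #|S|) (enum (F :\: S))].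
have DF : D \subset F :\: S.
  by apply/subsetP => x; rewrite inE => /mem_take; rewrite mem_enum.
have cD : #|D| = q - #|S|.
  rewrite cardsE (card_uniqP _) ?take_uniq ?enum_uniq // size_take -cardE.
  have -> : #|F :\: S| = #|F| - #|S| by rewrite cardsD (setIidPr SF).
  by case: ltnP => // h; apply/eqP; rewrite eqn_leq h leq_sub2r.
exists (S :|: D); first exact: subsetUl.
rewrite subUset SF (subset_trans DF (subsetDl _ _)) /=.
rewrite cardsU cD (_ : S :&: D = set0) ?cards0 ?subn0 ?subnKC //.
apply/eqP; rewrite setI_eq0 disjoint_sym.
by move: DF; rewrite subsetD => /andP[].
Qed.

Lemma legal_move_extend (T : finType) (q : nat) (S F : {set T}) :
  S \subset F -> #|S| <= q -> exists2 S', legal_move q F S' & S \subset S'.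
Proof.
move=> SF Sq.
have [|S' SS' S'F] := @exists_subset_card T S F (minn q #|F|) SF.
  by rewrite leq_min Sq (subset_leq_card SF) geq_minr.
by exists S'.
Qed.

(** * Forced conditions and extraction of a strategy *)

Section Forcing.
Variables (T : finType) (X : {set T}) (a b : nat).
Implicit Types (B M S m : {set T}) (P Q : {set T} -> {set T} -> Prop).

(** In a position [(B, M)] Breaker is to move. Being inductive, the predicate asks for success after
    finitely many rounds, so phases of play can be chained. *)
Inductive forces P : {set T} -> {set T} -> Prop :=
| forces_now B M : P B M -> forces P B M
| forces_move B M S :
    legal_move b (X :\: (B :|: M)) S ->
    (forall m, legal_move a (X :\: (B :|: M) :\: S) m ->
       forces P (B :|: S) (M :|: m)) ->
    forces P B M.

Lemma forces_bind P Q B M :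
  forces P B M -> (forall B' M', P B' M' -> forces Q B' M') -> forces Q B M.
Proof.
move=> h PQ; elim: h => {B M} [B M /PQ //|B M S lS _ IH].
exact: forces_move lS IH.
Qed.

(* Breaker may name fewer than [b] elements: the surplus of his move is absorbed
   in [B'], so conditions monotone in Breaker's set are unaffected. *)
Lemma forces_claim P B M S :
  S \subset X -> [disjoint S & M] -> #|S :\: B| <= b ->
  (forall B' m, B :|: S \subset B' -> m \subset X -> [disjoint m & B'] ->
     #|m| <= a -> forces P B' (M :|: m)) ->
  forces P B M.
Proof.
move=> SX SM Sb step.
have SF : S :\: B \subset X :\: (B :|: M).
  apply/subsetP => x; rewrite !inE negb_or => /andP[-> xS].
  by rewrite (subsetP SX) // (disjointFr SM).
have [S' lS' SS'] := legal_move_extend SF Sb.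
apply: forces_move lS' _ => m /andP[mF /eqP cm].
apply: step.
- rewrite subUset subsetUl -(setID S B) subUset setIC.
  by rewrite (subset_trans (subsetIl _ _)) ?subsetUl // (subset_trans SS') ?subsetUr.
- exact: subset_trans mF (subset_trans (subsetDl _ _) (subsetDl _ _)).
- rewrite -setI_eq0; apply/eqP/setP => x; rewrite !inE.
  case xm : (x \in m) => //=.
  have := subsetP mF _ xm; rewrite !inE negb_or => /andP[/negbTE-> /andP[/andP[/negbTE-> _] _]].
  by [].
- by rewrite cm geq_minl.
Qed.

Lemma legal_move_exists q (F : {set T}) : exists S, legal_move q F S.
Proof.
by have [|S lS _] := @legal_move_extend T q set0 F (sub0set _); rewrite ?cards0 //; exists S.
Qed.

Section Winning.
Variables (G : {set T} -> Prop) (maker_wins : pred {set T}).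
Hypothesis G_mono : forall B B', G B -> B \subset B' -> G B'.
Hypothesis G_wins : forall B M,
  M \subset X -> [disjoint B & M] -> G B -> ~~ maker_wins M.

Let good B M := forces (fun B _ => G B) B M.

(** On a full board both moves are empty and the position repeats, so a goal that can still be
    forced holds already. *)
Lemma forces_end B M : good B M -> X :\: (B :|: M) = set0 -> G B.
Proof.
elim=> {B M} // B M S lS _ IH F0.
move: lS; rewrite F0 /legal_move subset0 => /andP[/eqP S0 _].
have lm : legal_move a (X :\: (B :|: M) :\: S) set0.
  by rewrite F0 set0D /legal_move sub0set cards0 minn0 eqxx.
have := IH _ lm; rewrite S0 !setU0; exact.
Qed.

(** Once the goal holds, monotonicity lets Breaker make any legal move. *)
Lemma forces_good_move B M : good B M ->
  exists S, legal_move b (X :\: (B :|: M)) S /\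
    forall m, legal_move a (X :\: (B :|: M) :\: S) m -> good (B :|: S) (M :|: m).
Proof.
case=> {B M} [B M GB|B M S lS H]; last by exists S.
have [S lS] := legal_move_exists b (X :\: (B :|: M)).
exists S; split=> // m _; apply: forces_now.
exact: G_mono GB (subsetUl _ _).
Qed.

Lemma breaker_claims_rcons (h : history T) S m :
  breaker_claims (rcons h (S, m)) = breaker_claims h :|: S.
Proof. by rewrite /breaker_claims -cats1 big_cat big_seq1. Qed.

Lemma maker_claims_rcons (h : history T) S m :
  maker_claims (rcons h (S, m)) = maker_claims h :|: m.
Proof. by rewrite /maker_claims -cats1 big_cat big_seq1. Qed.

(** Choice selects a move after which every reply leaves a good position; goodness then persists
    along consistent histories until the board is full. *)
Lemma forces_winning_strategy :
  forces (fun B _ => G B) set0 set0 -> breaker_has_winning_strategy X a b maker_wins.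
Proof.
move=> start.
pose ok (h : history T) S := legal_move b (unclaimed X h) S /\
  forall m, legal_move a (unclaimed X h :\: S) m ->
    good (breaker_claims h :|: S) (maker_claims h :|: m).
pose s (h : history T) : {set T} :=
  if pselect (exists S, ok h S) is left e then projT1 (cid e) else set0.
have sP h : good (breaker_claims h) (maker_claims h) -> ok h (s h).
  move=> /forces_good_move e; rewrite /s; case: pselect => [e'|//].
  by case: (cid e').
have inv h : consistent X a s h ->
    [/\ good (breaker_claims h) (maker_claims h), maker_claims h \subset X &
        [disjoint breaker_claims h & maker_claims h]].
  elim=> [|{}h m _ [g MX BM] lm].
    by rewrite /breaker_claims /maker_claims !big_nil sub0set -setI_eq0 setI0 eqxx.
  have [/andP[sF _] sg] := sP _ g.
  rewrite breaker_claims_rcons maker_claims_rcons; split; first exact: sg.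
    rewrite subUset MX; case/andP: lm => mF _.
    exact: subset_trans mF (subset_trans (subsetDl _ _) (subsetDl _ _)).
  case/andP: lm => mF _; rewrite -setI_eq0; apply/eqP/setP => x; rewrite !inE.
  apply/negbTE/negP => /andP[/orP xB /orP xM].
  case: xM => [xM|/(subsetP mF)]; last first.
    by rewrite !inE negb_or; case: xB => ->; rewrite ?andbF.
  case: xB => [xB|/(subsetP sF)]; first by rewrite (disjointFr BM xB) in xM.
  by rewrite !inE xM orbT.
exists s => h /inv[g MX BM]; split; first by case: (sP _ g).
by move=> F0; apply: (G_wins MX BM); apply: (forces_end g).
Qed.

End Winning.
End Forcing.

Lemma card_bigcup_le (I T : finType) (A : {set I}) (F : I -> {set T}) (c : nat) :
  (forall i, i \in A -> #|F i| <= c) -> #|\bigcup_(i in A) F i| <= #|A| * c.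
Proof.
move=> Fc; rewrite -sum_nat_const.
elim/big_ind2: _ => //; first by rewrite cards0.
by move=> x1 x2 y1 y2 h1 h2; apply: leq_trans (leq_card_setU _ _) (leq_add h1 h2).
Qed.

(** * Stars and secured cliques in the complete graph *)

Section CompleteGraph.
Variables (n a b : nat).
Implicit Types (B M m : {set {set 'I_n}}) (C D : {set 'I_n}) (v : 'I_n).
Local Notation E := (complete_graph n).

Definition star v : {set {set 'I_n}} := [set e in E | v \in e].

Definition isolates B : Prop := exists v, star v \subset B.

Definition untouched M C : {set 'I_n} := [set v in C | [forall e in M, v \notin e]].

(** The invariant of both phases: an edge outside [B] meets [C] in at most one vertex, so the stars
    of [C] become disjoint boxes once [B] is removed. *)
Definition secured B M C : Prop :=
  (forall e, e \in E -> e \subset C -> e \in B) /\ untouched M C = C.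

Lemma untouched_sub M C : untouched M C \subset C.
Proof. by apply/subsetP => v; rewrite inE => /andP[]. Qed.

Lemma untouchedP M C :
  reflect (forall v e, v \in C -> e \in M -> v \notin e) (untouched M C == C).
Proof.
apply: (iffP eqP) => [<- v e|H].
  by rewrite inE => /andP[_ /forall_inP H] /H.
apply/setP => v; rewrite inE andb_idr // => vC.
by apply/forall_inP => e eM; apply: H eM.
Qed.

Lemma secured_sub B M C D : D \subset C -> secured B M C -> secured B M D.
Proof.
move=> DC [inB /eqP/untouchedP uM]; split.
  by move=> e eE eD; apply: inB eE (subset_trans eD DC).
by apply/eqP/untouchedP => v e vD; apply: uM; apply: (subsetP DC).
Qed.

(** Discarding the vertices that Maker has just touched restores the invariant. *)
Lemma secured_round B B' M m C :
  B \subset B' -> secured B M C -> secured B' (M :|: m) (untouched m C).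
Proof.
move=> BB' [inB /eqP/untouchedP uM]; split.
  move=> e eE eC; apply: (subsetP BB'); apply: inB => //.
  exact: subset_trans eC (untouched_sub _ _).
apply/eqP/untouchedP => v e; rewrite !inE => /andP[vC /forall_inP vm].
by case/orP=> [|/vm //]; apply: uM.
Qed.

(* An unclaimed edge leaves the clique [C], hence meets it in at most one vertex. *)
Lemma card_untouched_ge B M m C :
  secured B M C -> m \subset E -> [disjoint m & B] -> #|C| <= #|untouched m C| + #|m|.
Proof.
move=> [inB _] mE mB.
rewrite -(cardsID (untouched m C) C) (setIidPr (untouched_sub m C)) leq_add2l.
have /subset_leq_card/leq_trans : C :\: untouched m C \subset \bigcup_(e in m) (C :&: e).
  apply/subsetP => v; rewrite !inE => /andP[+ vC]; rewrite vC /=.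
  move/forallPn => [e]; rewrite negb_imply negbK => /andP[em ve].
  by apply/bigcupP; exists e => //; rewrite !inE vC.
apply; rewrite -[leqRHS]muln1; apply: card_bigcup_le => e em.
have eE := subsetP mE _ em; have ce : #|e| = 2 by move: eE; rewrite inE => /eqP.
rewrite -ltnS -ce; apply: proper_card; rewrite properE subsetIr /= subsetI subxx andbT.
by apply/negP => /(inB _ eE); rewrite (disjointFr mB em).
Qed.

Lemma card_star v : #|star v| <= n.-1.
Proof.
have /subset_leq_card/leq_trans : star v \subset [set [set v; u] | u in [set~ v]].
  apply/subsetP => e; rewrite !inE => /andP[/cards2P[x [y [xy ->]]]].
  rewrite !inE => /orP[]/eqP->; apply/imsetP.
    by exists y => //; rewrite !inE eq_sym.
  by exists x; rewrite ?inE // setUC.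
apply; apply: leq_trans (leq_imset_card _ _) _.
by rewrite cardsC1 card_ord.
Qed.

Lemma isolates_mono B B' : isolates B -> B \subset B' -> isolates B'.
Proof. by move=> [v vB] BB'; exists v; apply: subset_trans BB'. Qed.

Lemma isolates_wins k B M : 0 < k -> M \subset E -> [disjoint B & M] ->
  isolates B -> ~~ min_degree_ge k M.
Proof.
move=> k0 ME BM [v vB]; apply/forallPn; exists v.
rewrite -ltnNge /degree (_ : finset _ = set0) ?cards0 //.
apply/setP => e; rewrite !inE; apply/negbTE/negP => /andP[eM ve].
have : e \in B by apply: (subsetP vB); rewrite inE (subsetP ME).
by move/(disjointFr BM); rewrite eM.
Qed.

(* Box game on the stars of a secured clique, played backwards: with
   [1 + a * i] stars alive Breaker takes [b %/ (1 + a * i)] edges from each. *)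
Lemma forces_box (t : nat) B M C :
  secured B M C -> 1 + a * t <= #|C| ->
  (forall v, v \in C -> #|star v :\: B| <= \sum_(0 <= i < t.+1) b %/ (1 + a * i)) ->
  forces E a b (fun B _ => isolates B) B M.
Proof.
elim: t B M C => [|t IH] B M C secC cC rem.
  move: cC; rewrite muln0 addn0 card_gt0 => /set0Pn[v vC].
  have := rem v vC; rewrite big_nat1 muln0 divn1 => vb.
  apply: (@forces_claim _ _ _ _ _ _ _ (star v)) => //.
  - by apply/subsetP => e; rewrite inE => /andP[].
  - rewrite -setI_eq0; apply/eqP/setP => e; rewrite !inE; apply/negbTE/negP.
    case/andP=> /andP[_ ve] eM; case: secC => _ /eqP/untouchedP /(_ v e vC eM).
    by rewrite ve.
  - move=> B' m; rewrite subUset => /andP[_ vB'] _ _ _.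
    by apply: forces_now; exists v.
(* Surplus vertices are dropped, so that claiming [d] edges at each remaining one costs at most
   [b]. *)
wlog cC' : C secC cC rem / #|C| = 1 + a * t.+1 => [H|].
  have [|D _ /andP[DC /eqP cD]] := @exists_subset_card _ set0 C (1 + a * t.+1) (sub0set _).
    by rewrite cards0.
  apply: (H D) => //; [exact: secured_sub secC|by rewrite cD|].
  by move=> v vD; apply: rem; apply: (subsetP DC).
pose d := b %/ (1 + a * t.+1).
(* The implication makes the statement total in [v], so that choice yields a function [F]. A star
   with fewer than [d] edges left is taken whole. *)
have pick v : exists S : {set {set 'I_n}}, (v \in C) ==>
    [&& S \subset star v :\: B, #|S| <= d &
        #|(star v :\: B) :\: S| <= \sum_(0 <= i < t.+1) b %/ (1 + a * i)].
  have [vC|] := boolP (v \in C); last by exists set0.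
  have [S /andP[SF /eqP cS]] := legal_move_exists d (star v :\: B).
  exists S; rewrite SF cS geq_minl /= cardsD (setIidPr SF) cS.
  have := rem v vC; rewrite big_nat_recr //= -/d => h.
  lia.
pose F v := projT1 (cid (pick v)).
have FP v : v \in C -> [/\ F v \subset star v :\: B, #|F v| <= d &
    #|(star v :\: B) :\: F v| <= \sum_(0 <= i < t.+1) b %/ (1 + a * i)].
  by move=> vC; rewrite /F; case: (cid _) => S /=; rewrite vC => /and3P[].
apply: (@forces_claim _ _ _ _ _ _ _ (\bigcup_(v in C) F v)).
- apply/bigcupsP => v /FP[FS _ _]; apply: subset_trans FS _.
  by apply/subsetP => e; rewrite !inE => /and3P[].
- rewrite -setI_eq0; apply/eqP/setP => e; rewrite !inE; apply/negbTE/negP.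
  case/andP=> /bigcupP[v vC eF] eM; have [/subsetP/(_ _ eF)] := FP v vC.
  rewrite !inE => /and3P[_ _ ve] _ _.
  by case: secC => _ /eqP/untouchedP /(_ v e vC eM); rewrite ve.
- apply: leq_trans (subset_leq_card (subsetDl _ _)) _.
  apply: leq_trans (@card_bigcup_le _ _ _ _ d _) _; first by move=> v /FP[].
  by rewrite cC' mulnC leq_divM.
move=> B' m; rewrite subUset => /andP[BB' /bigcupsP FB'] mE mB' cm.
apply: (IH _ _ (untouched m C)).
- exact: secured_round secC.
- have mB : [disjoint m & B] by apply: disjointWr mB'.
  have := card_untouched_ge secC mE mB; rewrite cC' mulnS => h.
  lia.
- move=> v; rewrite inE => /andP[vC _]; have [_ _] := FP v vC.
  apply: leq_trans; apply: subset_leq_card; apply/subsetP => e.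
  rewrite !inE => /and3P[eB' -> ->]; rewrite !andbT.
  by rewrite (contra (subsetP (FB' v vC) e)) // (contra (subsetP BB' e)).
Qed.

(** * Building the clique *)

(** The state after [j] rounds: each gains [a.+1] vertices and loses at most [a], a net gain of one.
    The bound on [#|M|] keeps enough fresh vertices available. *)
Definition clique_stage j B M : Prop :=
  [/\ M \subset E, #|M| <= a * j & exists2 C, secured B M C & j <= #|C|].

(** A vertex that is neither in [C] nor fresh lies on a Maker edge, and each such edge has two
    ends. *)
Lemma card_untouched_compl M C :
  M \subset E -> n <= #|untouched M (~: C)| + #|C| + 2 * #|M|.
Proof.
move=> ME; have {1}-> : n = #|'I_n| by rewrite card_ord.
pose V := \bigcup_(e in M) e.
have cV : #|V| <= #|M| * 2.
  by apply: card_bigcup_le => e /(subsetP ME); rewrite inE => /eqP->.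
have : [set: 'I_n] \subset untouched M (~: C) :|: C :|: V.
  apply/subsetP => v _; rewrite !inE; case vC: (v \in C) => //=.
  rewrite orbF -implyNb; apply/implyP => /forallPn[e].
  by rewrite negb_imply negbK => /andP[eM ve]; apply/bigcupP; exists e.
move/subset_leq_card; rewrite cardsT => /leq_trans -> //.
apply: leq_trans (leq_card_setU _ _) _; rewrite mulnC.
by apply: leq_add cV; apply: leq_card_setU.
Qed.

Lemma forces_clique_step j B M :
  a.+1 * (j + a.+1) <= b -> j + a.+1 + 2 * (a * j) <= n ->
  clique_stage j B M -> forces E a b (clique_stage j.+1) B M.
Proof.
move=> jb jn [ME cM [C0 sec0 jC0]].
(* Trimming to exactly [j] vertices bounds the cost of the round. *)
have [|C _ /andP[CC0 /eqP cC]] := @exists_subset_card _ set0 C0 j (sub0set _).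
  by rewrite cards0.
have secC := secured_sub CC0 sec0.
have cU : a.+1 <= #|untouched M (~: C)|.
  by have := card_untouched_compl C ME; lia.
have [|A _ /andP[AU /eqP cA]] :=
    @exists_subset_card _ set0 _ a.+1 (sub0set (untouched M (~: C))).
  by rewrite cards0.
have uM : forall v e, v \in A :|: C -> e \in M -> v \notin e.
  move=> v e; rewrite inE => /orP[/(subsetP AU)|].
    by rewrite inE => /andP[_ /forall_inP]; apply.
  by case: secC => _ /eqP/untouchedP; apply.
have cAC : #|A :|: C| = j + a.+1.
  rewrite cardsU (_ : A :&: C = set0) ?cards0 ?subn0 ?cA ?cC; first by lia.
  apply/eqP; rewrite setI_eq0; apply/pred0P => v /=; apply/negP => /andP[/(subsetP AU)].
  by rewrite !inE => /andP[/negbTE->].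
pose S : {set {set 'I_n}} := [set e in E | e \subset A :|: C].
have secAC : secured (B :|: S) M (A :|: C).
  split; last by apply/eqP/untouchedP.
  by move=> e eE eAC; rewrite inE; apply/orP; right; rewrite !inE in eE *; rewrite eE.
apply: (@forces_claim _ _ _ _ _ _ _ S).
- by apply/subsetP => e; rewrite inE => /andP[].
- rewrite -setI_eq0; apply/eqP/setP => e; rewrite !inE; apply/negbTE/negP.
  case/andP=> /andP[ce eAC] eM.
  have [v ve] : exists v, v \in e by apply/set0Pn; rewrite -card_gt0 (eqP ce).
  by have := uM v e (subsetP eAC v ve) eM; rewrite ve.
(* A missing edge has an end outside [C], hence in the set [A] of new vertices; pairs in [A] times
   [A :|: C] therefore cover all missing edges. *)
- have /subset_leq_card/leq_trans : S :\: B \subset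
      [set [set p.1; p.2] | p in setX A (A :|: C)].
    apply/subsetP => e; rewrite inE => /andP[eB]; rewrite inE => /andP[eE eAC].
    have [v ve vC] : exists2 v, v \in e & v \notin C.
      by apply/subsetPn; apply: (contra _ eB); case: secC => inB _; apply: inB.
    have vA : v \in A by have := subsetP eAC v ve; rewrite inE (negbTE vC) orbF.
    have [u [_ ee]] : exists u, u \in A :|: C /\ e = [set v; u].
      move: eE eAC ve; rewrite inE => /cards2P[x [y [_ ->]]].
      rewrite subUset !sub1set => /andP[xAC yAC]; rewrite !inE => /orP[]/eqP->.
        by exists y.
      by exists x; rewrite [[set y; x]]setUC.
    apply/imsetP; exists (v, u); last by [].
    by rewrite inE vA /=; apply: (subsetP eAC); rewrite ee !inE eqxx orbT.
  apply; apply: leq_trans (leq_imset_card _ _) _.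
  by rewrite cardsX cA cAC.
move=> B' m BSB' mE mB' cm; apply: forces_now; split.
- by rewrite subUset ME.
- by rewrite mulnS; have := leq_of_leqif (leq_card_setU M m); lia.
exists (untouched m (A :|: C)); first exact: secured_round secAC.
have mB : [disjoint m & B :|: S] by apply: disjointWr mB'.
by have := card_untouched_ge secAC mE mB; rewrite cAC; lia.
Qed.

(** Both numerical conditions are monotone in [j], so they cover all earlier rounds. *)
Lemma forces_clique j :
  a.+1 * (j + a.+1) <= b -> j + a.+1 + 2 * (a * j) <= n ->
  forces E a b (clique_stage j) set0 set0.
Proof.
elim: j => [|j IH] jb jn.
  apply: forces_now; split; rewrite ?sub0set ?cards0 //.
  exists set0; last by rewrite cards0.
  split; last by apply/eqP/untouchedP => v e; rewrite inE.
  by move=> e; rewrite inE subset0 => /[swap] /eqP->; rewrite cards0.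
apply: forces_bind (IH _ _) _; [by nia|by nia|].
by move=> B M; apply: forces_clique_step; nia.
Qed.

(** The clique phase lasts [1 + a * t] rounds. The box phase may then ignore edges Breaker already
    holds, since a star has at most [n.-1] edges. *)
Lemma breaker_wins_box k t : 0 < k ->
  a.+1 * (1 + a * t + a.+1) <= b ->
  1 + a * t + a.+1 + 2 * (a * (1 + a * t)) <= n ->
  n.-1 <= \sum_(0 <= i < t.+1) b %/ (1 + a * i) ->
  breaker_has_winning_strategy E a b (min_degree_ge k).
Proof.
move=> k0 tb tn nsum.
apply: (@forces_winning_strategy _ _ _ _ isolates).
- exact: isolates_mono.
- by move=> B M ME BM; apply: isolates_wins.
apply: forces_bind (forces_clique tb tn) _ => B M [_ _ [C secC tC]].
apply: (forces_box secC tC) => v _.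
by apply: leq_trans nsum; apply: leq_trans (card_star v); rewrite subset_leq_card ?subsetDl.
Qed.

Lemma breaker_wins_star k : 0 < k -> 0 < n -> n.-1 <= b ->
  breaker_has_winning_strategy E a b (min_degree_ge k).
Proof.
move=> k0 n0 nb.
apply: (@forces_winning_strategy _ _ _ _ isolates).
- exact: isolates_mono.
- by move=> B M ME BM; apply: isolates_wins.
apply: (@forces_claim _ _ _ _ _ _ _ (star (Ordinal n0))).
- by apply/subsetP => e; rewrite inE => /andP[].
- by rewrite -setI_eq0 setI0.
- by rewrite setD0 (leq_trans (card_star _)).
- move=> B' m; rewrite set0U => sB' _ _ _; apply: forces_now.
  by exists (Ordinal n0).
Qed.

End CompleteGraph.

(* Only now, since the names of [classical_sets] shadow those of [finset]. *)
From mathcomp Require Import ring lra.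
From mathcomp Require Import all_classical all_reals all_analysis.
Import Order.TTheory GRing.Theory Num.Theory.
Import numFieldNormedType.Exports.
Local Open Scope classical_set_scope.
Local Open Scope ring_scope.

(** * Logarithmic estimates *)

Lemma ln_le_subr1 (R : realType) (x : R) : 0 < x -> ln x <= x - 1.
Proof. by move=> x0; have := le_ln1Dx (x := x - 1); rewrite subrKC; apply; lra. Qed.

(** The term at 0 is [b]. For larger [i], [1 + a * i <= a * (i + 1)] compares the sum with a
    harmonic one, bounded below by telescoping logarithms; each of these [t] floors loses at most
    1. *)
Lemma box_sum_ge (R : realType) (a b t : nat) : (0 < a)%N ->
  b%:R / a%:R * (a%:R + ln t.+2%:R - 1) - t%:R
    <= (\sum_(0 <= i < t.+1) b %/ (1 + a * i))%:R :> R.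
Proof.
move=> a0; have aR : 0 < a%:R :> R by rewrite ltr0n.
have b0 : 0 <= b%:R / a%:R :> R by rewrite divr_ge0.
elim: t => [|t IH].
  rewrite big_nat1 muln0 divn1 subr0.
  have -> : b%:R = b%:R / a%:R * a%:R :> R by rewrite divfK ?gt_eqF.
  rewrite mulfK ?gt_eqF // ler_wpM2l //.
  have := @ln_le_subr1 R 2%:R ltac:(lra); lra.
rewrite big_nat_recr //= natrD.
set d := (b %/ _)%N.
have t2 : 0 < t.+2%:R :> R by rewrite ltr0n.
have step : ln t.+3%:R - ln t.+2%:R <= t.+2%:R^-1 :> R.
  rewrite -ln_div ?posrE ?ltr0n //.
  apply: le_trans (ln_le_subr1 _) _; first by rewrite divr_gt0 ?ltr0n.
  by rewrite -[t.+3]addn1 natrD mulrDl divff ?gt_eqF // mul1r addrAC subrr add0r.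
have dge : b%:R / a%:R / t.+2%:R - 1 <= d%:R :> R.
  have -> : b%:R / a%:R / t.+2%:R = b%:R / (a * t.+2)%:R :> R.
    by rewrite natrM invfM mulrA.
  rewrite lerBlDr natr1 ler_pdivrMr ?ltr0n ?muln_gt0 ?a0 // -natrM ler_nat.
  apply: leq_trans (ltnW (ltn_ceil b (_ : 0 < 1 + a * t.+1)%N)) _ => //.
  by rewrite leq_mul2l (mulnS a t.+1) leq_add2r a0 orbT.
have {}step := ler_wpM2l b0 step.
rewrite -[t.+1%:R in leLHS]natr1; move: step dge IH b0.
move: (b%:R / a%:R) (ln t.+3%:R) (ln t.+2%:R) (\sum_(_ <= _ < _) _)%N => c x y s.
by move: t.+2%:R a%:R t%:R d%:R s%:R => *; lra.
Qed.

(** Collects everything required of [L = ln n] for large [n]; [c] and [d] stand for the constants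
    built from [eps]. *)
Lemma large_log (R : realType) (c d : R) : 0 < c -> 0 < d <= 3^-1 ->
  exists L0 : R, forall L, L0 <= L ->
    [/\ 1 <= L, 324 * (c * (c + 1)) <= L, 12 * (c * (c + 1)) * L ^+ 2 <= expR L,
        3 * ln L + 1 <= 2 * d * L & 1 <= d * L ^+ 3].
Proof.
move=> c0 /andP[d0 d3].
have lnd : ln (d / 3) <= 0 by rewrite ln_le0 //; lra.
(* All summands are nonnegative, so [L] dominates each of them. *)
exists (1 + 324 * (c * (c + 1)) + d^-1 - 3 * ln (d / 3) / d) => L hL.
have cc : 0 < c * (c + 1) by nra.
have di : 0 < d^-1 by rewrite invr_gt0.
have e1 : 0 <= - (3 * ln (d / 3) / d) by rewrite -mulNr divr_ge0 //; lra.
have L1 : 1 <= L by lra.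
have L2 : 324 * (c * (c + 1)) <= L by lra.
have dd : d * d^-1 = 1 by rewrite divff ?gt_eqF.
split=> //.
- have L0 : 0 <= L by lra.
  (* The cubic term [L ^+ 3 / 6] is already at least [54 * (c * (c + 1)) * L ^+ 2]. *)
  have := expR_ge1Dxn 2 L0; rewrite (_ : 3`!%:R = 6 :> R) // exprS => eL.
  have h := exprn_ge0 2 L0; have := ler_wpM2r h L2; have := mulr_ge0 (ltW cc) h.
  by move: (L ^+ 2) (c * (c + 1)) (expR L) eL {h} => *; lra.
- have e3 : - (3 * ln (d / 3)) <= d * L.
    by rewrite [d * L]mulrC -ler_pdivrMr // mulNr; lra.
  (* Rescaling by [d / 3] makes the linear bound on [3 * ln L] have slope [d]; [e3] absorbs the
     constant into another [d * L]. *)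
  have := @ln_le_subr1 R (d / 3 * L) ltac:(nra).
  rewrite lnM ?posrE; [|lra|lra]; lra.
- have : d^-1 <= L by lra.
  move=> /(ler_wpM2l (ltW d0)); rewrite dd => /le_trans -> //.
  by rewrite ler_wpM2l ?ler_eXnr // ltW.
Qed.

Lemma log_conditions (R : realType) (eps : R) (n a b : nat) :
  0 < eps -> (0 < a)%N -> (b < n.-1)%N ->
  (1 + eps) * (a%:R * n%:R / (a%:R + ln n%:R)) <= b%:R ->
  let c := eps^-1 in let d := eps / (3 * (1 + eps)) in let L := ln n%:R in
  1 <= L -> 324 * (c * (c + 1)) <= L -> 12 * (c * (c + 1)) * L ^+ 2 <= n%:R ->
  3 * ln L + 1 <= 2 * d * L -> 1 <= d * L ^+ 3 ->
  exists t : nat, [/\ (a.+1 * (1 + a * t + a.+1) <= b)%N,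
    (1 + a * t + a.+1 + 2 * (a * (1 + a * t)) <= n)%N &
    (n.-1 <= \sum_(0 <= i < t.+1) b %/ (1 + a * i))%N].
Proof.
move=> e0 a0 bn hb; set c := eps^-1; set d := eps / _; set L := ln _ => /=.
rewrite -/L in hb *; move=> L1 cL cL2 lnL dL.
have c0 : 0 < c by rewrite invr_gt0.
have a1 : 1 <= a%:R :> R by rewrite ler1n.
have n0 : 0 < n%:R :> R by rewrite ltr0n; lia.
have bnR : b%:R <= n%:R :> R by rewrite ler_nat; lia.
have de : d * (3 * (1 + eps)) = eps by rewrite /d divfK // gt_eqF //; lra.
have d0 : 0 < d by rewrite divr_gt0 //; lra.
have ce : c * eps = 1 by rewrite mulVf // gt_eqF.
have LE : L = ln n%:R by [].
move: (L) LE L1 cL cL2 lnL dL hb => {L} L LE L1 cL cL2 lnL dL hb.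
clearbody c d.
have L0 : 0 < L by lra.
have aL0 : 0 < a%:R + L by lra.
have {}hb : (1 + eps) * (a%:R * n%:R) <= b%:R * (a%:R + L).
  by rewrite -ler_pdivrMr // -mulrA.
(* Using [b <= n] in the bias bound and cancelling [n] leaves [(1 + eps) * a <= a + L]. *)
have aL : a%:R <= c * L.
  have h : eps * a%:R <= L.
    have := le_trans hb (ler_wpM2r (ltW aL0) bnR).
    rewrite mulrA [n%:R * _]mulrC ler_pM2r //; lra.
  by have := ler_wpM2l (ltW c0) h; rewrite mulrA ce mul1r.
have LX0 : 0 < L ^+ 3 by rewrite exprn_gt0.
(* The witness is [t], the floor of [n / L ^+ 3]. *)
have tP := truncn_itv (ltW (divr_gt0 n0 LX0)).
set t := Num.trunc _ in tP; case/andP: tP => t1 t2.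
have {}t1 : t%:R * L ^+ 3 <= n%:R by rewrite -ler_pdivlMr.
have t0 : 0 <= t%:R :> R by [].
(* [Y] bounds [a], [a * a] and [a * (a + L)], while [Y] and [t * Y] are small fractions of [n]; the
   first two conditions follow from this. *)
pose Y := c * (c + 1) * L ^+ 2.
have L20 : 0 <= L ^+ 2 by rewrite exprn_ge0 // ltW.
have aY : a%:R * (a%:R + L) <= Y.
  have -> : Y = (c * L) * ((c + 1) * L) by rewrite /Y; ring.
  by apply: ler_pM; lra.
have nY : 12 * Y <= n%:R by rewrite /Y mulrA.
have tY : 324 * (t%:R * Y) <= n%:R.
  apply: le_trans t1.
  have -> : 324 * (t%:R * Y) = t%:R * (324 * (c * (c + 1)) * L ^+ 2).
    by rewrite /Y; ring.
  by rewrite ler_wpM2l // exprS ler_wpM2r.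
clearbody Y.
have aa : a%:R * a%:R <= Y by apply: le_trans aY; nra.
have a2 : a%:R <= a%:R * a%:R :> R by nra.
exists t; split.
- rewrite -(ler_nat R) -(ler_pM2r aL0); apply: le_trans hb.
  rewrite natrM !natrD natrM -[a.+1%:R]natr1.
  have h1 : (a%:R + 1) * (1 + a%:R * t%:R + (a%:R + 1)) <=
      a%:R * (2 * (a%:R * (t%:R + 3))) :> R.
    have -> : a%:R * (2 * (a%:R * (t%:R + 3))) = (2 * a%:R) * (a%:R * t%:R + 3 * a%:R) :> R by ring.
    by apply: ler_pM; nra.
  apply: le_trans (ler_wpM2r (ltW aL0) h1) _.
  have h2 : 2 * (t%:R + 3) * (a%:R * (a%:R + L)) <= n%:R.
    have := ler_wpM2l (_ : 0 <= 2 * (t%:R + 3)) aY.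
    by move/(_ ltac:(lra)); lra.
  have -> : a%:R * (2 * (a%:R * (t%:R + 3))) * (a%:R + L) =
     a%:R * (2 * (t%:R + 3) * (a%:R * (a%:R + L))) :> R by ring.
  have h3 := ler_wpM2l (_ : 0 <= a%:R) h2; apply: le_trans (h3 _) _; first lra.
  by rewrite ler_peMl ?mulr_ge0 //; lra.
- rewrite -(ler_nat R) !(natrD, natrM) -[a.+1%:R]natr1.
  have := ler_wpM2l t0 aa; have := ler_wpM2l t0 a2; lra.
- suff : n%:R <= (\sum_(0 <= i < t.+1) b %/ (1 + a * i))%:R :> R.
    by rewrite ler_nat; apply: leq_trans; apply: leq_pred.
  apply: le_trans (box_sum_ge R b t a0).
  have lnt : L - 3 * ln L <= ln t.+2%:R.
    have -> : L - 3 * ln L = ln (n%:R / L ^+ 3).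
      by rewrite ln_div ?posrE // lnXn // LE mulr_natl.
    rewrite ler_ln ?posrE ?divr_gt0 // (le_trans (ltW t2)) //.
    by rewrite ler_nat.
  (* Replacing [ln n] by [ln t.+2] and subtracting 1 costs at most [3 * ln L + 1], hence at most
     [2 * d * L]. *)
  have h1 : (1 - 2 * d) * (a%:R + L) <= a%:R + ln t.+2%:R - 1 by nra.
  have tn : t%:R <= d * n%:R.
    apply: le_trans (ler_wpM2l (ltW d0) t1).
    by have := ler_wpM2l t0 dL; rewrite mulr1 mulrCA.
  have h2 : (1 + eps) * n%:R <= b%:R / a%:R * (a%:R + L).
    by rewrite mulrAC ler_pdivlMr ?ltr0n // -mulrA [n%:R * _]mulrC.
  have b0 : 0 <= b%:R / a%:R :> R by rewrite divr_ge0.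
  have d2 : 0 <= 1 - 2 * d by nra.
  have h3 := ler_wpM2l b0 h1; have h4 := ler_wpM2l d2 h2.
  have h5 : 0 <= d * eps * n%:R by rewrite !mulr_ge0 // ltW.
  (* Here [eps = 3 * d * (1 + eps)] pays for the logarithmic loss and for the rounding loss [d * n],
     leaving [d * eps * n] to spare. *)
  have h6 : (1 - 2 * d) * ((1 + eps) * n%:R) - d * n%:R = n%:R + d * eps * n%:R.
    have dn : eps * n%:R = d * (3 * (1 + eps)) * n%:R by rewrite de.
    lra.
  have h7 : b%:R / a%:R * ((1 - 2 * d) * (a%:R + L)) =
      (1 - 2 * d) * (b%:R / a%:R * (a%:R + L)) by ring.
  rewrite h7 in h3; move: (le_trans h4 h3) h6 tn h5.
  move: (b%:R / a%:R * _) ((1 - 2 * d) * _) => u v; lra.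
Qed.

Theorem theorem12 (R : realType) (a k : nat -> nat)
    (a_gt0 : forall n : nat, (0 < a n)%N)
    (k_gt0 : forall n : nat, (0 < k n)%N)
    (k_small : (fun n : nat => (k n)%:R : R) =o_\oo (fun n : nat => n%:R : R))
    (a_small : (fun n : nat => (a n)%:R : R)
                 =o_\oo (fun n : nat => Num.sqrt (n%:R : R)))
    (eps : R) (eps_gt0 : 0 < eps) :
  exists n0 : nat, forall n : nat, (n0 <= n)%N -> forall b : nat,
    (1 + eps) * ((a n)%:R * n%:R / ((a n)%:R + ln n%:R)) <= b%:R ->
    breaker_has_winning_strategy (complete_graph n) (a n) b
      (min_degree_ge (k n)).
Proof.
pose c := eps^-1; pose d := eps / (3 * (1 + eps)).
have c0 : 0 < c by rewrite invr_gt0.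
have d0 : 0 < d <= 3^-1.
  rewrite divr_gt0 //=; last by lra.
  by rewrite ler_pdivrMr; lra.
have [L0 large] := large_log c0 d0.
(* Beyond this threshold [ln n] is at least [L0]. *)
exists (Num.trunc (expR L0)).+1 => n nL b hb.
have nR : expR L0 <= n%:R.
  have /andP[_ /ltW h] := truncn_itv (expR_ge0 L0).
  by apply: le_trans h _; rewrite ler_nat.
have n0 : (0 < n)%N by apply: leq_trans nL.
have [nb|bn] := leqP n.-1 b; first exact: breaker_wins_star.
have nK : expR (ln n%:R) = n%:R :> R by rewrite lnK // posrE ltr0n.
have [|L1 cL cL2 lnL dL] := large (ln n%:R); first by rewrite -ler_expR nK.
rewrite nK in cL2.
have [t [h1 h2 h3]] := log_conditions eps_gt0 (a_gt0 n) bn hb L1 cL cL2 lnL dL.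
exact: (breaker_wins_box (k_gt0 n) h1 h2 h3).
Qed.
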